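(* Let $d\ge 1$ and $\Delta\ge 3$ be integers. If $G$ is a $d$-degenerate graph of maximum degree $\Delta$ and chromatic number $\chi$, then \[\chi'_{\mathrm{inj}}(G)\le \lceil 4ed\log\Delta\rceil\,(2d+1)\,\chi.\]
   Context: All graphs are finite and simple. An injective edge-coloring of a graph $G$ is a function $\psi:E(G)\to\mathbb N$ such that whenever $\psi(e)=\psi(e')$ for distinct edges $e,e'$, no third edge of $G$ joins an endpoint of $e$ to an endpoint of $e'$. The injective chromatic index $\chi'_{\mathrm{inj}}(G)$ is the minimum $k$ such that $G$ has an injective edge-coloring with colors in $\{1,\dots,k\}$. A graph is $d$-degenerate if every subgraph has a vertex of degree at most $d$. $\log$ is the natural logarithm and $e$ is Euler's number. *)

(* Defs.v *)
From HB Require Import structures.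
From mathcomp Require Import all_boot all_order all_algebra.
From mathcomp Require Import all_classical all_reals all_analysis.
Set Implicit Arguments.
Unset Strict Implicit.
Unset Printing Implicit Defensive.

Record sgraph := SGraph {
  vertex :> finType;
  adj : rel vertex;
  adj_sym : symmetric adj;
  adj_irrefl : irreflexive adj }.

Definition edges (G : sgraph) : {set {set G}} :=
  [set [set p.1; p.2] | p : G * G & adj p.1 p.2].

Definition edge (G : sgraph) : finType := {f : {set G} | f \in edges G}.

Definition degree (G : sgraph) (x : G) : nat := #|[set y | adj x y]|.

Definition max_degree (G : sgraph) : nat := \max_(x : G) degree x.

(* Subgraphs are arbitrary (not only induced): a vertex set S together with
   a symmetric sub-relation h of adjacency supported on S. *)
Definition is_subgraph (G : sgraph) (S : {set G}) (h : rel G) : Prop :=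
  symmetric h /\ forall x y, h x y -> [/\ x \in S, y \in S & adj x y].

(* The subgraph with no vertices is excluded. *)
Definition degenerate (d : nat) (G : sgraph) : Prop :=
  forall (S : {set G}) (h : rel G), is_subgraph S h -> S != finset.set0 ->
  exists2 x, x \in S & #|[set y | h x y]| <= d.

Definition proper_coloring (G : sgraph) (C : Type) (c : G -> C) : Prop :=
  forall x y, adj x y -> c x <> c y.

Definition colorable (G : sgraph) (k : nat) : Prop :=
  exists c : G -> 'I_k, proper_coloring c.

Lemma colorable_exists (G : sgraph) : exists k, `[< colorable G k >].
Proof.
exists #|G|; apply/asboolP; exists enum_rank => x y xy /enum_rank_inj exy.
by rewrite exy adj_irrefl in xy.
Qed.

Definition chromatic_number (G : sgraph) : nat := ex_minn (colorable_exists G).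

Definition joins (G : sgraph) (f e1 e2 : edge G) : Prop :=
  exists x y, [/\ x \in val e1, y \in val e2 & val f = [set x; y]].

Definition injective_edge_coloring (G : sgraph) (psi : edge G -> nat) : Prop :=
  forall e1 e2 : edge G, e1 != e2 -> psi e1 = psi e2 ->
  ~ exists f : edge G, [/\ f != e1, f != e2 & joins f e1 e2].

Definition injectively_edge_colorable (G : sgraph) (k : nat) : Prop :=
  exists psi : edge G -> nat,
    injective_edge_coloring psi /\ forall e, 1 <= psi e <= k.

Lemma injectively_edge_colorable_exists (G : sgraph) :
  exists k, `[< injectively_edge_colorable G k >].
Proof.
exists #|edge G|; apply/asboolP; exists (fun e => (enum_rank e).+1); split.
  by move=> e1 e2 ne [] /ord_inj/enum_rank_inj e12; rewrite e12 eqxx in ne.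
by move=> e /=; apply: ltn_ord.
Qed.

Definition injective_chromatic_index (G : sgraph) : nat :=
  ex_minn (injectively_edge_colorable_exists G).

(* Main.v *)
(* Rank the vertices so that every vertex has at most d neighbours of smaller
   rank (its back neighbours), and view each edge as going from its upper end v
   to its lower end u.  Draw t = ceil(4 e d log Delta) random vertex sets S_i,
   each vertex being in S_i with probability 1/d.  An edge v -> u is isolated by
   S_i when u is the only back neighbour of v in S_i; no S_i isolates it with
   probability at most (1 - 1/(e d))^t <= Delta^-4.  As d may be assumed to be at
   most Delta, the local lemma produces sets isolating every edge.

   Fix i and a colour class of a proper vertex colouring.  The edges v -> u
   isolated by S_i with v in the class form stars centred in S_i whose leaves are
   pairwise nonadjacent.  If two stars conflict, then one centre, u, precedes the
   other, u', and either u or a leaf of u is a back neighbour of u'; as each leaf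
   has a single centre, at most 2d stars with an earlier centre conflict with the
   one of u', so that 2d + 1 colours separate the stars greedily. *)
Require Import Defs.
From mathcomp Require Import all_boot all_order all_algebra.
From mathcomp Require Import all_classical all_reals all_analysis.
From mathcomp Require Import ring lra zify.
Import Order.TTheory GRing.Theory Num.Theory.
Local Open Scope ring_scope.
Set Implicit Arguments.
Unset Strict Implicit.
Unset Printing Implicit Defensive.

(** * Lovasz local lemma, with probabilities as cardinality ratios *)

Definition depends_on (I T : finType) (N : {set I}) (A : {set {ffun I -> T}}) :=
  forall w w' : {ffun I -> T}, {in N, w =1 w'} -> (w \in A) = (w' \in A).

(** Exchanging the coordinates outside [N] between the members of a pair is an involution, and it
    pulls [A] times [B] back to the pairs whose first member lies in both [A] and [B]. *)
Lemma card_setI_indep (I T : finType) (N : {set I}) (A B : {set {ffun I -> T}}) :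
  depends_on N A -> depends_on (~: N)%SET B ->
  (#|A :&: B| * #|{ffun I -> T}| = #|A| * #|B|)%N.
Proof.
move=> AN BN.
pose merge (w w' : {ffun I -> T}) := [ffun i => if i \in N then w i else w' i].
pose swap p := (merge p.1 p.2, merge p.2 p.1).
have swapK : involutive swap.
  by move=> [w w']; congr (_, _); apply/ffunP => i; rewrite !ffunE; case: (i \in N).
rewrite -cardsT -!cardsX -(card_imset _ (can_inj swapK)).
congr #|pred_of_set _|; rewrite (can2_imset_pre _ swapK swapK).
apply/setP => -[w w']; rewrite !inE andbT /=; congr andb.
  by apply: AN => i iN; rewrite ffunE iN.
by apply: BN => i; rewrite inE => /negPf iN; rewrite ffunE iN.
Qed.

Section LocalLemma.
Variables (R : realFieldType) (I J T : finType).
Variables (N : J -> {set I}) (A : J -> {set {ffun I -> T}}) (D : nat) (x : R).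
Hypotheses (x_ge0 : 0 <= x) (x_lt1 : x < 1).
Hypothesis A_dep : forall j, depends_on (N j) (A j).
Hypothesis N_deg :
  forall j, (#|[set k | (k != j) && ~~ [disjoint N j & N k]]| <= D)%N.
Hypothesis A_small :
  forall j, #|A j|%:R <= x * (1 - x) ^+ D * #|{ffun I -> T}|%:R.

Let avoid (S : {set J}) := [set w | [forall k in S, w \notin A k]].

Let avoidU1 k S : avoid (k |: S) = avoid S :\: A k.
Proof.
apply/setP => w; rewrite !inE; apply/forall_inP/andP => [av|[wk /forall_inP av] i].
  by split; [|apply/forall_inP => i iS]; apply: av; rewrite !inE ?eqxx ?iS ?orbT.
by rewrite !inE => /predU1P[->|/av].
Qed.

(** A conditional probability bound. Dropping from [S] the events [S1] that may depend on [A j]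
    bounds the numerator by independence; induction restores them in the denominator at a cost of
    [1 - x] each. *)
Lemma card_bad_avoid (S : {set J}) j : j \notin S ->
  #|A j :&: avoid S|%:R <= x * #|avoid S|%:R.
Proof.
have x'_ge0 : 0 <= 1 - x by rewrite subr_ge0 ltW.
have [n] := ubnP #|S|; elim: n S j => // n IHn S j ltSn jS.
pose S1 := [set k in S | ~~ [disjoint N j & N k]].
pose S2 := [set k in S | [disjoint N j & N k]].
have step (S' : {set J}) k : (#|S'| < n)%N -> k \notin S' ->
    (1 - x) * #|avoid S'|%:R <= #|avoid (k |: S')|%:R.
  move=> ltS' kS'; have := IHn _ _ ltS' kS'.
  rewrite avoidU1 -[#|avoid S'|](cardsID (A k)) natrD finset.setIC; lra.
have chain m (U : {set J}) : #|U| = m -> U \subset S1 ->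
    (1 - x) ^+ m * #|avoid S2|%:R <= #|avoid (U :|: S2)|%:R.
  elim: m U => [|m IHm] U cU US.
    by rewrite (cards0_eq cU) finset.set0U expr0 mul1r.
  have [k kU] : exists k, k \in U by apply/set0Pn; rewrite -card_gt0 cU.
  have cU' : #|U :\ k| = m by have := cardsD1 k U; rewrite kU cU => -[->].
  have kS1 : k \in S1 by apply: (fintype.subsetP US).
  have kS2 : k \notin (U :\ k) :|: S2.
    by move: kS1; rewrite !inE eqxx /= => /andP[-> /negPf->].
  rewrite -(finset.setD1K kU) -finset.setUA exprS -mulrA.
  apply: le_trans (step _ _ _ kS2).
    by rewrite ler_wpM2l// IHm// (fintype.subset_trans _ US)// subsetDl.
  rewrite -ltnS; apply: leq_trans ltSn; apply: proper_card; rewrite properE; apply/andP; split.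
    apply/fintype.subsetP => i; rewrite !inE => /orP[/andP[_ iU]|/andP[]//].
    by move/fintype.subsetP: US => /(_ _ iU); rewrite inE => /andP[].
  apply/fintype.subsetPn; exists k => //.
  by move: kS1; rewrite inE => /andP[].
have S12 : S1 :|: S2 = S.
  by apply/setP => k; rewrite !inE; case: (k \in S); case: [disjoint _ & _].
have cS1 : (#|S1| <= D)%N.
  apply: leq_trans (N_deg j); apply/subset_leq_card/fintype.subsetP => k.
  rewrite !inE => /andP[kS ->]; rewrite andbT.
  by apply: contraNneq jS => <-.
have avdep : depends_on (~: N j)%SET (avoid S2).
  move=> w w' ww'; rewrite !inE; apply: eq_forallb_in => k.
  rewrite inE => /andP[_ jk]; congr negb; apply: A_dep => i ik; apply: ww'.
  by rewrite inE; apply: contraL ik => ij; rewrite (disjointFr jk).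
have indep := card_setI_indep (@A_dep j) avdep.
have avS : avoid S \subset avoid S2.
  apply/fintype.subsetP => w; rewrite !inE => /forall_inP av.
  by apply/forall_inP => k; rewrite inE => /andP[kS _]; apply: av.
have bad2 : #|A j :&: avoid S|%:R <= x * (1 - x) ^+ D * #|avoid S2|%:R.
  have [w0|w_gt0] := posnP #|{ffun I -> T}|.
    rewrite (_ : #|_ :&: _| = 0)%N ?mulr_ge0 ?exprn_ge0//.
    by apply/eqP; rewrite -leqn0 -w0 max_card.
  apply: (@le_trans _ _ #|A j :&: avoid S2|%:R).
    by rewrite ler_nat subset_leq_card// finset.setIS.
  rewrite -(ler_pM2r (_ : 0 < #|{ffun I -> T}|%:R)) ?ltr0n// -natrM indep natrM.
  by rewrite mulrAC ler_wpM2r.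
apply: le_trans bad2 _; rewrite -mulrA ler_wpM2l//.
rewrite -[in leRHS]S12; apply: le_trans (chain _ _ erefl (fintype.subxx _)).
by rewrite ler_wpM2r// ler_wiXn2l// lerBlDr lerDl.
Qed.

Lemma local_lemma : (0 < #|{ffun I -> T}|)%N -> exists w, forall j, w \notin A j.
Proof.
move=> w_gt0.
have avP (S : {set J}) : (0 < #|avoid S|)%N.
  have [n] := ubnP #|S|; elim: n S => // n IHn S ltSn.
  have [->|[k kS]] := set_0Vmem S.
    rewrite (_ : avoid _ = [set: _]) ?cardsT//; apply/setP => w; rewrite !inE.
    by apply/forall_inP => k; rewrite inE.
  have cS := cardsD1 k S; rewrite kS in cS.
  have {}IHn := IHn (S :\ k) ltac:(lia).
  have kS' : k \notin S :\ k by rewrite !inE eqxx.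
  have := card_bad_avoid kS'; rewrite finset.setIC => bad.
  rewrite -(finset.setD1K kS) avoidU1.
  have := cardsID (A k) (avoid (S :\ k)).
  (* If nothing survived, [A k] would fill the nonempty set avoiding the rest: a ratio of 1 against
     the bound [x < 1]. *)
  have [c0|//] := posnP #|avoid (S :\ k) :\: A k|.
  rewrite c0 addn0 => E; move: bad; rewrite E -(ltr0n R) in IHn *.
  by rewrite ler_pMl// leNgt x_lt1.
have /card_gt0P[w] := avP [set: J].
by rewrite inE => /forall_inP w_av; exists w => j; apply: w_av.
Qed.

End LocalLemma.

(** * Greedy colouring and degeneracy orderings *)

Lemma greedy_coloring (V : finType) (k : nat) (f : V -> nat) (r : rel V) :
  (forall x y, r x y -> f y < f x)%N ->
  (forall x, #|[set y | r x y]| <= k)%N ->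
  exists c : V -> 'I_k.+1, forall x y, r x y -> c x <> c y.
Proof.
move=> rf rk.
have free (c : V -> 'I_k.+1) x : exists a, a \notin c @: [set y | r x y].
  apply/existsP; rewrite -negb_forall; apply/negP => /forallP all_in.
  have : (#|'I_k.+1| <= #|c @: [set y | r x y]|)%N.
    by rewrite -cardsT; apply/subset_leq_card/fintype.subsetP.
  by have := leq_imset_card c [set y | r x y]; have := rk x; rewrite card_ord; lia.
suff /(_ (\max_x f x).+1)[c cP] : forall n, exists c : V -> 'I_k.+1,
    forall x y, (f x < n)%N -> r x y -> c x <> c y.
  by exists c => x y; apply: cP; rewrite ltnS leq_bigmax.
elim=> [|n [c cP]]; first by exists (fun=> ord0).
(* All elements of rank [n] are coloured at once: [r] strictly lowers [f], so none constrains
   another. *)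
exists (fun x => if f x == n then xchoose (free c x) else c x) => x y.
rewrite ltnS => fxn rxy; have fyx := rf _ _ rxy.
rewrite [f y == n]ltn_eqF; last exact: leq_trans fyx fxn.
case: eqP => [_|/eqP fxn']; last by apply: cP => //; rewrite ltn_neqAle fxn' fxn.
move=> E; have := xchooseP (free c x); rewrite E => /negP; apply.
by apply: imset_f; rewrite inE.
Qed.

Definition back_nbrs (G : sgraph) (f : G -> nat) (v : G) : {set G} :=
  [set u | adj v u && (f u < f v)%N].

(** Built from the top: a vertex of degree at most [d] in the subgraph induced on [S] gets the
    largest rank, and the rest are ranked by induction. *)
Lemma degenerate_ranking (d : nat) (G : sgraph) : degenerate d G ->
  exists2 f : G -> nat, injective f & forall v, (#|back_nbrs f v| <= d)%N.
Proof.
move=> Gd.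
suff main n (S : {set G}) : #|S| = n -> exists f : G -> nat,
    [/\ {in S &, injective f}, {in S, forall v, (f v < n)%N} &
     {in S, forall v, #|[set u in S | adj v u && (f u < f v)%N]| <= d}%N].
  have [f [f_inj _ fd]] := main _ [set: G] erefl.
  exists f => [x y /f_inj|v]; first by apply; rewrite inE.
  apply: leq_trans (fd v (finset.in_setT v)); apply/subset_leq_card/fintype.subsetP => u.
  by rewrite !inE.
elim: n S => [|n IHn] S cS.
  by exists (fun=> 0%N); rewrite (cards0_eq cS); split=> v; rewrite inE.
have [||x xS xd] := Gd S (fun x y => [&& x \in S, y \in S & adj x y]).
- split=> [x y|x y /and3P[]//]; rewrite adj_sym.
  by case: (x \in S); case: (y \in S).
- by rewrite -card_gt0 cS.
have cSx : #|S :\ x| = n by have := cardsD1 x S; rewrite xS cS => -[->].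
have [f [f_inj f_lt fd]] := IHn _ cSx.
have Sx y : y \in S -> y != x -> y \in S :\ x by move=> yS yx; rewrite !inE yx.
exists (fun y => if y == x then n else f y); split.
- move=> y z yS zS; case: eqVneq => [->|yx]; case: eqVneq => [->|zx] //.
  + by move=> E; have := f_lt _ (Sx _ zS zx); rewrite -E ltnn.
  + by move=> E; have := f_lt _ (Sx _ yS yx); rewrite E ltnn.
  + by apply: f_inj; apply: Sx.
- by move=> y yS; case: eqVneq => [//|yx]; rewrite ltnS ltnW// f_lt ?Sx.
- move=> y yS; case: eqVneq => [->|yx].
    apply: leq_trans xd; apply/subset_leq_card/fintype.subsetP => u.
    by rewrite !inE xS => /and3P[-> -> _].
  apply: leq_trans (fd _ (Sx _ yS yx)).
  apply/subset_leq_card/fintype.subsetP => u; rewrite !inE => /and3P[-> ->].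
  case: eqVneq => //= _ lt_nf; have := f_lt _ (Sx _ yS yx).
  by rewrite ltnNge ltnW.
Qed.

(** * Random sets isolating the edges *)

Lemma card_bigcup_le (I T : finType) (P : pred I) (F : I -> {set T}) :
  (#|\bigcup_(i | P i) F i| <= \sum_(i | P i) #|F i|)%N.
Proof.
elim/big_rec2: _ => [|i n A _ IH]; first by rewrite cards0.
by apply: leq_trans (leq_card_setU _ _) _; rewrite leq_add2l.
Qed.

Lemma bernoulli_ge (R : realFieldType) (x : R) n : 0 <= x -> x <= 1 ->
  1 - n%:R * x <= (1 - x) ^+ n.
Proof.
move=> x0 x1; elim: n => [|n IHn]; first by rewrite mul0r subr0 expr0.
rewrite exprS; apply: le_trans (ler_wpM2l _ IHn); last by rewrite subr_ge0.
have := mulr_ge0 (ler0n R n) (mulr_ge0 x0 x0); rewrite -natr1; lra.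
Qed.

(** For positive [d], [1 - 1/(d+1)] is the inverse of [1 + 1/d], and [(1 + 1/d)^d <= e]. *)
Lemma expRN1_le (R : realType) (d k : nat) : (k <= d)%N ->
  expR (-1) <= (1 - d.+1%:R^-1) ^+ k :> R.
Proof.
move=> kd; have [d0|d_gt0] := posnP d.
  move: kd; rewrite d0 leqn0 => /eqP ->.
  by rewrite expr0 -[leRHS]expR0 ler_expR lerN10.
have dR : 0 < d%:R :> R by rewrite ltr0n.
have E : 1 - d.+1%:R^-1 = (1 + d%:R^-1)^-1 :> R.
  by rewrite -natr1; field; rewrite !natr1 !pnatr_eq0; lia.
rewrite E exprVn expRN lef_pV2 ?posrE ?expR_gt0 ?exprn_gt0 ?ltr_wpDr ?invr_ge0//.
apply: (@le_trans _ _ ((1 + d%:R^-1) ^+ d)).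
  by rewrite ler_weXn2l// lerDl invr_ge0 ltW.
rewrite -[in leRHS](mulfV (lt0r_neq0 dR)) expRM_natl.
by rewrite lerXn2r ?nnegrE ?expR_ge0 ?expR_ge1Dx// addr_ge0 ?invr_ge0 ?ltW.
Qed.

(** The label [ord0] selects a point with probability [1/(d+1)]. Selecting [u] has that probability;
    independently, the at most [d] other points of [B] are all rejected with probability at least
    [1/e]. *)
Lemma card_isolating (R : realType) (d : nat) (V : finType) (B : {set V}) u :
  u \in B -> (#|B| <= d.+1)%N ->
  (expR 1 * d.+1%:R)^-1 * (d.+1 ^ #|V|)%:R <=
  #|[set g : {ffun V -> 'I_d.+1} | B :&: [set z | g z == ord0] == [set u]]|%:R :> R.
Proof.
move=> uB Bd.
pose F z : {pred 'I_d.+1} :=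
  if z == u then pred1 ord0 else if z \in B then predC1 ord0 else predT.
apply: (@le_trans _ _ #|family F|%:R); last first.
  rewrite ler_nat; apply/subset_leq_card/fintype.subsetP => g /familyP gF.
  rewrite inE; apply/eqP/setP => z; rewrite !inE.
  have := gF z; rewrite /F; case: eqVneq => [->|zu]; first by rewrite uB.
  by case: (z \in B) => //; rewrite inE => /negPf.
have p_gt0 : 0 < d.+1%:R :> R by rewrite ltr0n.
have -> : #|family F|%:R = d.+1%:R ^+ #|V| *
    \prod_z (if z == u then d.+1%:R^-1 else if z \in B then 1 - d.+1%:R^-1 else 1) :> R.
  rewrite card_family foldrE big_image natr_prod /=.
  rewrite -[in RHS]prodr_const -big_split /=; apply: eq_bigr => z _.
  rewrite /F; case: ifP => _; first by rewrite card1 divff// lt0r_neq0.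
  case: ifP => _; last by rewrite card_ord mulr1.
  have := cardC1 (@ord0 d); rewrite card_ord => -> /=.
  by rewrite mulrBr mulr1 divff ?lt0r_neq0// -natr1 addrK.
rewrite natrX mulrC ler_pM2l ?exprn_gt0//.
rewrite (bigD1 u)//= eqxx invfM mulrC ler_pM2l ?invr_gt0//.
rewrite (eq_bigr (fun z => if z \in B then 1 - d.+1%:R^-1 else 1)); last first.
  by move=> z /negPf->.
rewrite -big_mkcondr /= (eq_bigl [in B :\ u]); last by move=> z; rewrite !inE.
rewrite prodr_const -expRN; apply: expRN1_le.
by have := cardsD1 u B; rewrite uB; lia.
Qed.

Section IsolatingSets.
Variables (R : realType) (d Delta t : nat) (V : finType) (B : V -> {set V}).
Hypothesis B_small : forall v, (#|B v| <= d.+1)%N.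
Hypothesis B_deg : forall u, (#|[set v | u \in B v]| <= Delta)%N.
Hypotheses (d_lt_Delta : (d < Delta)%N) (Delta_gt1 : (1 < Delta)%N).
Hypothesis t_ge : 4 * expR 1 * d.+1%:R * ln Delta%:R <= t%:R :> R.

Let Omega := {ffun 'I_t * V -> 'I_d.+1}.
Let sel (w : Omega) i := [set z | w (i, z) == ord0].
Let fail v u := [set w : Omega | [forall i, B v :&: sel w i != [set u]]].

(** The [t] rounds are independent and, by [1 - y <= exp(-y)], each fails with probability at most
    [exp(-1/(e(d+1)))]; [t_ge] brings the [t]-th power down to [Delta^-4]. *)
Lemma card_fail v u : u \in B v ->
  #|fail v u|%:R <= Delta%:R ^- 4 * #|{: Omega}|%:R :> R.
Proof.
move=> uB.
pose Q := [set g : {ffun V -> 'I_d.+1} | B v :&: [set z | g z == ord0] == [set u]].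
pose curry (w : Omega) : {ffun 'I_t -> {ffun V -> 'I_d.+1}} :=
  [ffun i => [ffun z => w (i, z)]].
have curry_inj : injective curry.
  move=> w w' /ffunP ww'; apply/ffunP => -[i z].
  by have /ffunP/(_ z) := ww' i; rewrite !ffunE.
have -> : #|{: Omega}| = ((d.+1 ^ #|V|) ^ t)%N.
  by rewrite card_ffun card_prod !card_ord mulnC expnM.
have fail_le : (#|fail v u| <= #|~: Q| ^ t)%N.
  rewrite -(card_imset (fail v u) curry_inj).
  have <- : #|(ffun_on (mem (~: Q)) : {pred {ffun 'I_t -> _}})| = (#|~: Q| ^ t)%N.
    by rewrite card_ffun_on card_ord.
  apply/subset_leq_card/fintype.subsetP => _ /imsetP[w wP ->]; move: wP.
  rewrite inE => /forallP wv; apply/ffun_onP => i; rewrite !inE ffunE.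
  apply: contraNN (wv i) => /eqP <-; apply/eqP; congr (_ :&: _).
  by apply/setP => z; rewrite !inE ffunE.
have a_gt0 : 0 < (d.+1 ^ #|V|)%:R :> R by rewrite ltr0n expn_gt0.
have Delta_gt0 : 0 < Delta%:R :> R by rewrite ltr0n; lia.
have ed_gt0 : 0 < expR 1 * d.+1%:R :> R by rewrite mulr_gt0 ?expR_gt0 ?ltr0n.
have Qc_le : #|~: Q|%:R <= expR (- (expR 1 * d.+1%:R)^-1) * (d.+1 ^ #|V|)%:R :> R.
  have := card_isolating R uB (B_small v); rewrite -/Q => Q_ge.
  have := congr1 (fun n => n%:R : R) (cardsC Q); rewrite card_ffun card_ord natrD.
  have := ler_wpM2r (ltW a_gt0) (expR_ge1Dx (- (expR 1 * d.+1%:R)^-1 : R)).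
  rewrite mulrDl mul1r mulNr; move: Q_ge; set b := _^-1 * _; set c := _ * _; lra.
apply: le_trans (_ : (#|~: Q| ^ t)%:R <= _); first by rewrite ler_nat.
apply: (@le_trans _ _ ((expR (- (expR 1 * d.+1%:R)^-1) * (d.+1 ^ #|V|)%:R) ^+ t)).
  by rewrite natrX lerXn2r ?nnegrE// mulr_ge0 ?expR_ge0.
rewrite exprMn [in leRHS]natrX ler_wpM2r ?exprn_ge0// -expRM_natl.
rewrite -[in leRHS](lnK Delta_gt0) -expRM_natl -expRN ler_expR mulrN lerN2.
by rewrite ler_pdivlMr//; apply: le_trans t_ge; lra.
Qed.

(** The local lemma gets one event per [v]: some [u] in [B v] is never isolated. A union bound over
    at most [Delta] such [u] gives [Delta^-3], and at most [Delta (Delta - 1)] other [k] have [B k]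
    meeting [B v]. *)
Lemma isolating_sets :
  exists S : 'I_t -> {set V},
    forall v u, u \in B v -> exists i, B v :&: S i = [set u].
Proof.
pose N v := [set p : 'I_t * V | p.2 \in B v].
pose A v := \bigcup_(u in B v) fail v u.
(* With D = Delta (Delta - 1), this choice gives x (1 - D x) = Delta ^- 3. *)
pose x : R := Delta%:R ^- 2.
have Delta_ge2 : 2 <= Delta%:R :> R by rewrite (ler_nat _ 2).
have x_gt0 : 0 < x by rewrite invr_gt0 exprn_gt0//; lra.
have x_lt1 : x < 1 by rewrite invf_lt1 ?exprn_gt0 ?exprn_egt1//; lra.
have [||||w wP] := @local_lemma R _ _ _ N A (Delta * Delta.-1) x (ltW x_gt0) x_lt1.
- suff sub v (w w' : Omega) : {in N v, w =1 w'} -> w \in A v -> w' \in A v.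
    by move=> v w w' ww'; apply/idP/idP; apply: sub => // p pN; rewrite ww'.
  move=> ww' /bigcupP[u uB]; rewrite inE => /forallP wv.
  apply/bigcupP; exists u => //; rewrite inE; apply/forallP => i.
  apply: contraNN (wv i) => /eqP <-; apply/eqP/setP => z; rewrite !inE.
  by case: (boolP (z \in B v)) => //= zB; rewrite ww'// inE.
- move=> v; apply: (@leq_trans (\sum_(u in B v) Delta.-1)); last first.
    by rewrite sum_nat_const leq_mul2r (leq_trans (B_small v)) ?orbT.
  apply: (@leq_trans #|\bigcup_(u in B v) ([set k | u \in B k] :\ v)|).
    apply/subset_leq_card/fintype.subsetP => k; rewrite inE => /andP[kv].
    rewrite -setI_eq0 => /set0Pn[[i u]]; rewrite !inE /= => /andP[uv uk].
    by apply/bigcupP; exists u => //; rewrite !inE kv.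
  apply: leq_trans (card_bigcup_le _ _) _; apply: leq_sum => u uv.
  by have := cardsD1 v [set k | u \in B k]; rewrite inE uv; have := B_deg u; lia.
- move=> v; apply: (@le_trans _ _ (Delta%:R ^- 3 * #|{: Omega}|%:R)).
    apply: (@le_trans _ _ (\sum_(u in B v) #|fail v u|%:R)).
      by rewrite -natr_sum ler_nat card_bigcup_le.
    apply: le_trans (ler_sum _ (fun u uv => card_fail uv)) _.
    rewrite sumr_const -[leLHS]mulr_natl mulrA ler_wpM2r// exprS invfM mulrA.
    rewrite ler_piMl ?invr_ge0 ?exprn_ge0// ler_pdivrMr ?mul1r ?ler_nat; last lra.
    exact: leq_trans (B_small v) _.
  rewrite ler_wpM2r//; apply: le_trans (ler_wpM2l _ (bernoulli_ge _ _ _)) => //; last 3 first.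
  + exact: ltW.
  + exact: ltW.
  + exact: ltW.
  rewrite natrM (_ : Delta.-1%:R = Delta%:R - 1) /x; last by rewrite -subn1 natrB//; lia.
  by rewrite le_eqVlt; apply/orP; left; apply/eqP; field; lra.
- by rewrite card_ffun card_ord expn_gt0.
exists (sel w) => v u uB; have := wP v; apply: contraNP => noi.
apply/bigcupP; exists u => //; rewrite inE; apply/forallP => i.
by apply/eqP => E; apply: noi; exists i.
Qed.

End IsolatingSets.

(** * Conflicts between stars *)

Lemma center_coloring (G : sgraph) (f : G -> nat) (d : nat) (S : {set G}) :
  injective f -> (forall v, #|back_nbrs f v| <= d)%N ->
  exists rho : G -> 'I_(2 * d).+1, forall u v u' v',
    back_nbrs f v :&: S = [set u] -> back_nbrs f v' :&: S = [set u'] ->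
    u != u' -> adj u u' || adj v u' || adj u v' -> rho u <> rho u'.
Proof.
move=> f_inj fd.
pose B := back_nbrs f.
(* Arrows go from the later centre [u'] to the earlier [u]. Edges between two leaves are left to the
   vertex colouring. *)
pose r u' u := (f u < f u')%N &&
  (adj u' u || [exists v in B u', B v :&: S == [set u]]).
(* The centre of the star with leaf [v]. The default [u0] is harmless, since only the size of the
   image over [B x] is used. *)
pose g v u0 : G := odflt u0 [pick u | B v :&: S == [set u]].
have [|x|rho rhoP] := @greedy_coloring _ (2 * d) f r.
- by move=> u' u /andP[].
- have sub : [set y | r x y] \subset B x :|: [set g v x | v in B x].
    apply/fintype.subsetP => u; rewrite inE => /andP[ux /orP[xu|]].
      by rewrite !inE xu ux.
    case/exists_inP => v vB vu; rewrite inE; apply/orP; right.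
    apply/imsetP; exists v => //; rewrite /g; case: pickP => [y|/(_ u)].
      by move: vu => /eqP-> /eqP/set1_inj.
    by rewrite vu.
  apply: leq_trans (subset_leq_card sub) _.
  apply: leq_trans (leq_card_setU _ _) _.
  have := fd x; have := leq_imset_card (g^~ x) (B x); rewrite -/B; lia.
exists rho => u v u' v' vu vu' uu'.
have inS y z : B y :&: S = [set z] -> [/\ adj y z, (f z < f y)%N & z \in S].
  by move=> /setP/(_ z); rewrite !inE eqxx => /andP[/andP[]].
(* A leaf [y] of [z] adjacent to another centre [z'] precedes [z'], as [z] is
   the only centre preceding [y]; hence [f z < f y < f z']. *)
have far y z y' z' : B y :&: S = [set z] -> B y' :&: S = [set z'] ->
    z != z' -> adj y z' -> r z' z.
  move=> yz yz' zz' ayz'; have [_ zy _] := inS _ _ yz; have [_ _ z'S] := inS _ _ yz'.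
  have yz'_lt : (f y < f z')%N.
    rewrite ltn_neqAle; apply/andP; split.
      by apply: contraTneq ayz' => /f_inj ->; rewrite adj_irrefl.
    rewrite leqNgt; apply: contra zz' => z'y; rewrite eq_sym -finset.in_set1 -yz.
    by rewrite !inE ayz' z'y.
  rewrite /r (ltn_trans zy yz'_lt); apply/orP; right; apply/exists_inP; exists y.
    by rewrite inE adj_sym ayz'.
  by rewrite yz.
move=> /orP[/orP[auu'|avu']|auv'] E.
- have [lt|lt|/f_inj fuu'] := ltngtP (f u) (f u').
  + by apply: (rhoP u' u); rewrite // /r lt adj_sym auu'.
  + by apply: (rhoP u u'); rewrite // /r lt auu'.
  + by rewrite fuu' eqxx in uu'.
- exact: (rhoP _ _ (far _ _ _ _ vu vu' uu' avu')).
- by apply: (rhoP _ _ (far _ _ _ _ vu' vu _ _)); rewrite 1?eq_sym // adj_sym.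
Qed.

(** * Assembling the edge colouring *)

Lemma edge_orientation (G : sgraph) (f : G -> nat) (e : edge G) : injective f ->
  exists p : G * G, val e = [set p.1; p.2] /\ p.2 \in back_nbrs f p.1.
Proof.
move=> f_inj; have /imsetP[[x y] /= xy exy] := valP e.
have [lt|lt|/f_inj fxy] := ltngtP (f x) (f y).
- by exists (y, x); rewrite exy finset.setUC inE adj_sym; move: xy; rewrite inE /= => ->.
- by exists (x, y); rewrite exy inE; move: xy; rewrite inE /= => ->.
- by move: xy; rewrite inE /= fxy adj_irrefl.
Qed.

Lemma edge_adj (G : sgraph) (e : edge G) x y : val e = [set x; y] -> adj x y.
Proof.
have /imsetP[[a b] /=] := valP e; rewrite inE /= => ab -> E.
have := set21 x y; have := set22 x y; have := set21 a b; have := set22 a b.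
rewrite -E {1 2}E !inE.
have aNb : a != b by apply: contraTneq ab => ->; rewrite adj_irrefl.
move=> /orP[/eqP bE|/eqP bE] /orP[/eqP aE|/eqP aE];
  rewrite ?aE ?bE ?eqxx// in aNb ab *; rewrite 1?adj_sym//.
Qed.

(** An edge is coloured by a round isolating it, the colour of its centre (lower end) in that round,
    and the vertex colour of its leaf (upper end). *)
Lemma injectively_edge_colorable_degenerate (R : realType) (d Delta t : nat)
    (G : sgraph) : degenerate d.+1 G -> max_degree G = Delta ->
  (d < Delta)%N -> (1 < Delta)%N ->
  4 * expR 1 * d.+1%:R * ln Delta%:R <= t%:R :> R ->
  injectively_edge_colorable G (t * (2 * d.+1 + 1) * chromatic_number G).
Proof.
move=> Gd GD dD D1 t_ge.
have [f f_inj fd] := degenerate_ranking Gd.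
have Bdeg u : (#|[set v | u \in back_nbrs f v]| <= Delta)%N.
  rewrite -GD; apply: leq_trans (leq_bigmax u).
  apply/subset_leq_card/fintype.subsetP => v; rewrite !inE adj_sym.
  by case/andP.
have [S SP] := isolating_sets fd Bdeg dD D1 t_ge.
have [rho rhoP] := choice (fun i => center_coloring (S i) f_inj fd).
have [c cP] : colorable G (chromatic_number G).
  by rewrite /chromatic_number; case: ex_minnP => k /asboolP.
have [ends endsP] := choice (fun e : edge G => edge_orientation e f_inj).
have [round roundP] := choice (fun e : edge G => SP _ _ (endsP e).2).
pose col e := (round e, rho (round e) (ends e).2, c (ends e).1).
exists (fun e => (enum_rank (col e)).+1); split; last first.
  move=> e; rewrite /= (leq_trans (ltn_ord _))// !card_prod !card_ord.
  by rewrite addn1.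
move=> e e' ne [/ord_inj/enum_rank_inj[Es Er Ec]] [h [he he' [x [y [xe ye' hxy]]]]].
have axy := edge_adj hxy.
have [vE vB] := endsP e; have [vE' vB'] := endsP e'.
have iso := roundP e; have iso' := roundP e'; rewrite -Es in iso' Er.
move: xe ye'; rewrite vE vE' !inE.
have [uu'|uu'] := eqVneq (ends e).2 (ends e').2; last first.
  have indep b := rhoP (round e) _ _ _ _ iso iso' uu' b Er.
  case/orP => /eqP xE /orP[] /eqP yE; rewrite xE yE in axy.
  - exact: (cP _ _ axy).
  - by apply: indep; rewrite axy orbT.
  - by apply: indep; rewrite axy !orbT.
  - by apply: indep; rewrite axy.
(* Within one star, [c] keeps leaves nonadjacent, a leaf-to-centre edge is [e] or [e'] itself, and
   the centres coincide. *)
case/orP => /eqP xE /orP[] /eqP yE; rewrite xE yE in axy hxy.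
- exact: (cP _ _ axy).
- by rewrite -uu' -vE in hxy; case/eqP: he; apply: val_inj.
- by rewrite uu' finset.setUC -vE' in hxy; case/eqP: he'; apply: val_inj.
- by rewrite uu' adj_irrefl in axy.
Qed.

Lemma degenerate_max_degree (G : sgraph) : degenerate (max_degree G) G.
Proof.
move=> S h [_ hS] /set0Pn[x xS]; exists x => //.
apply: leq_trans (leq_bigmax x); apply/subset_leq_card/fintype.subsetP => y.
by rewrite !inE => /hS[].
Qed.

Theorem theorem2p1 (R : realType) (d Delta : nat) (G : sgraph)
    (d_ge1 : (1 <= d)%N) (Delta_ge3 : (3 <= Delta)%N)
    (G_degenerate : degenerate d G) (G_max_degree : max_degree G = Delta) :
  (injective_chromatic_index G)%:Z <=
    Num.ceil (4 * expR 1 * d%:R * ln (Delta%:R : R)) *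
      (2 * d + 1)%N%:Z * (chromatic_number G)%:Z.
Proof.
(* If [d] exceeds [Delta], the graph is also [Delta]-degenerate and the bound for [Delta] is no
   larger. *)
wlog dD : d d_ge1 G_degenerate / (d <= Delta)%N.
  move=> main; have [/main|Dd] := leqP d Delta; first exact.
  have GD := degenerate_max_degree (G := G); rewrite G_max_degree in GD.
  have lnD : 0 <= ln (Delta%:R : R) by rewrite ln_ge0// ler1n; lia.
  apply: le_trans (main Delta _ GD _) _ => //; first lia.
  rewrite ler_wpM2r//; apply: ler_pM => //; last by lia.
    by rewrite -(ler_int R); apply: le_trans (ceil_ge _); rewrite !mulr_ge0 ?expR_ge0.
  by apply: ceil_le; rewrite ler_wpM2r// ler_wpM2l ?mulr_ge0 ?expR_ge0// ler_nat ltnW.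
case: d d_ge1 G_degenerate dD => // d _ Gd dD.
set a := 4 * _ * _ * _.
have a_ge0 : 0 <= a.
  by rewrite !mulr_ge0 ?expR_ge0// ln_ge0// ler1n; lia.
have := ceil_ge a.
have : 0 <= Num.ceil a by rewrite -(ler_int R) (le_trans a_ge0)// ceil_ge.
case: (Num.ceil a) => // t _ t_ge.
rewrite -!PoszM lez_nat /injective_chromatic_index; case: ex_minnP => k _; apply.
apply/asboolP; apply: (injectively_edge_colorable_degenerate (R := R) (Delta := Delta)) => //.
exact: leq_trans Delta_ge3.
Qed.
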